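(* There is an absolute constant $C>0$ such that the following holds. Let $(X,\rho)$ be any metric space, and let $A,B\subset X$ be finite sets with $m=|A|$ and $n=|B|$. Then any simple shortest $(A,B)$-network in $X$ has at most $C(m^2n+mn^2)$ Steiner points. (That is, the number of Steiner points is $O(m^2n+mn^2)$.)
   Context: Digraphs are finite, and their edges are ordered pairs of distinct vertices; both $(x,y)$ and $(y,x)$ may be edges. For finite subsets $A,B$ of a metric space $(X,\rho)$, an $(A,B)$-network (directed network connecting $A$ to $B$) is a digraph $G=(V,E)$ such that $A\cup B\subseteq V\subseteq X$ and for each $a\in A$ and $b\in B$ there is a directed path from $a$ to $b$ in $G$ (a single vertex counts as a path from itself to itself). The length of $G$ is $\ell(G)=\sum_{(x,y)\in E}\rho(x,y)$. The Steiner points of $G$ are the vertices in $V\setminus(A\cup B)$. A shortest $(A,B)$-network in $X$ is an $(A,B)$-network of minimum length among all $(A,B)$-networks in $X$ (provided it exists). An $(A,B)$-network is simple if each of its Steiner points has at least three neighbours, where a neighbour of a vertex $v$ is a vertex $w\neq v$ such that $(v,w)\in E$ or $(w,v)\in E$. *)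

(* Defs.v *)
From HB Require Import structures.
From mathcomp Require Import all_boot all_order all_algebra finmap.
From mathcomp Require Import reals topology.

Set Implicit Arguments.
Unset Strict Implicit.
Unset Printing Implicit Defensive.

Local Open Scope fset_scope.
Local Open Scope ring_scope.

Record digraph (T : choiceType) := Digraph {
  vertices : {fset T};
  edges : {fset T * T};
  edgesP : forall x y : T, (x, y) \in edges ->
    [/\ x \in vertices, y \in vertices & x != y]
}.

Definition edge_rel (T : choiceType) (G : digraph T) : rel T :=
  fun x y => (x, y) \in edges G.

(* [:: a] itself (p = [::]) is a path from a to a; as usual for paths, as
   opposed to walks, no vertex is repeated. *)
Definition dipath (T : choiceType) (G : digraph T) (a b : T) : Prop :=
  a \in vertices G /\
  exists p : seq T, [/\ path (edge_rel G) a p, uniq (a :: p) & last a p = b].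

Definition network (T : choiceType) (A B : {fset T}) (G : digraph T) : Prop :=
  A `|` B `<=` vertices G /\
  forall a b : T, a \in A -> b \in B -> dipath G a b.

Definition steiner_points (T : choiceType) (A B : {fset T}) (G : digraph T) :
  {fset T} := vertices G `\` (A `|` B).

Definition neighbours (T : choiceType) (G : digraph T) (v : T) : {fset T} :=
  [fset w in vertices G | (w != v) && (edge_rel G v w || edge_rel G w v)].

Definition simple_network (T : choiceType) (A B : {fset T}) (G : digraph T) :
  Prop :=
  network A B G /\
  forall v : T, v \in steiner_points A B G -> (3 <= #|` neighbours G v|)%N.

Definition network_length (R : realType) (X : metricType R) (G : digraph X) :
  R := \sum_(e <- edges G) mdist e.1 e.2.

Definition shortest_network (R : realType) (X : metricType R)
    (A B : {fset X}) (G : digraph X) : Prop :=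
  network A B G /\
  forall H : digraph X, network A B H -> network_length G <= network_length H.

(* Main.v *)
Require Import Defs.
From mathcomp Require Import all_boot all_order all_algebra finmap.
From mathcomp Require Import reals topology boolp.
From mathcomp Require Import zify lra.

Set Implicit Arguments.
Unset Strict Implicit.
Unset Printing Implicit Defensive.
Import Order.TTheory GRing.Theory Num.Theory.

(** Let G be a shortest (A,B)-network.  Deleting an edge shortens G, so every
edge is critical: some a in A and b in B are joined only by paths through it.
In particular no edge can be bypassed by the rest of G.  Every Steiner point is
an end of an edge, hence lies on a path P from a to b fixed in advance for one
of the mn pairs (a,b).  It is therefore enough to find O(m+n) Steiner points on
each P.

P traverses strong components of G one after the other and meets each of them
in a segment.  Close up the segment by a return path Q, inside the component,
from its exit t to its entry s.  Call a vertex of the segment or of Q attached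
if it is a terminal or an end of an edge that lies neither on P nor on Q.

There are at most 2(m+n) attached vertices for each P.  An edge (x,u) off P and
Q is critical for reaching u from some c in A.  If (x',u') is another such edge
with the same c, then P and the return paths lead from u to u' or from u' to u
without these two edges, and in both directions if u and u' share a component;
the two criticalities are then incompatible (same_critical_edge).  So entering
edges inject into A, and leaving edges into B (card_entered, card_exited).

It remains to see that Steiner points on P stay close to attached vertices.
All edges at an unattached vertex v are on P or Q.  Since v has three
neighbours, it is on both paths, which run in opposite directions.  As no edge
can be bypassed, an edge of Q off P must land before everything that Q has
visited (records).  This forces P and Q to look like a ladder: around a step
(b,c) that they share, P reads x,b,c,y and Q reads z,b,c,w, where w is x or
(w,x) is shared, and y is z or (y,z) is shared (turn).  Now there are two ways
to rewire the ladder: replace (b,c), (c,y), (c,w) by (b,z), (b,x), or replace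
(b,c), (x,b), (z,b) by (w,c), (y,c).  Both keep all connections
(exchange_joins), and the two changes of length add up to -2d(b,c), so one of
the new networks is shorter than G.  Hence there is no shared step far from the
marked vertices, which are s, t and the attached ones.  Without shared steps
a vertex would have only two neighbours, so every Steiner point on P is within
four steps of a marked vertex along P and Q (marked_nearby).  A component that
contains a Steiner point of P also contains an attached vertex, since otherwise
the first edge of Q would be superfluous (attached_exists); so marked vertices
are at most three times as numerous as attached ones.

The argument is carried out for a symmetric positive length on pairs from a
finite type, which in the end is the vertex set of G; all rewired networks have
the same vertices as G. *)

(** * Reachability *)

Section Reachability.
Variable V : finType.
Implicit Types (F E : {set V * V}) (h : V * V) (x y c u v : V).

Definition conn F x y := connect (fun u v => (u, v) \in F) x y.

Lemma conn0 F x : conn F x x.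
Proof. exact: connect0. Qed.

Lemma conn_trans F : transitive (conn F).
Proof. exact: connect_trans. Qed.

Lemma conn1 F x y : (x, y) \in F -> conn F x y.
Proof. by move=> xy; apply: connect1. Qed.

(** The way to show that a modified edge set still connects: move the vertices
that lost their edges. *)
Lemma conn_retract F F' (phi : V -> V) :
  (forall x y, (x, y) \in F -> conn F' (phi x) (phi y)) ->
  forall x y, conn F x y -> conn F' (phi x) (phi y).
Proof.
move=> FF' x _ /connectP[p Fp ->]; elim: p x Fp => [|y p IHp] x /=.
  by move=> _; apply: conn0.
by case/andP=> xy /IHp; apply: conn_trans; apply: FF'.
Qed.

Lemma conn_sub F F' x y : F \subset F' -> conn F x y -> conn F' x y.
Proof.
by move=> /subsetP sFF'; apply: (@conn_retract F F' id) => a b /sFF'/conn1.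
Qed.

(** A path through the edge h can be cut at its first and at its last passage
through h, which leaves two pieces that avoid h. *)
Lemma conn_split F h x y : conn F x y ->
  conn (F :\ h) x y \/ conn (F :\ h) x h.1 /\ conn (F :\ h) h.2 y.
Proof.
case/connectP=> p Fp ->; elim: p x Fp => [|z p IHp] x /=.
  by left; apply: conn0.
case/andP=> xz /IHp zy; have [hE|nh] := eqVneq (x, z) h.
  by right; rewrite -hE in zy *; split; [apply: conn0 | case: zy => [|[]]].
have xz' : conn (F :\ h) x z by apply: conn1; rewrite !inE nh.
by case: zy => [zy|[zh hy]]; [left|right; split=> //]; apply: conn_trans xz' _.
Qed.

Definition rev_edges F : {set V * V} := [set e | (e.2, e.1) \in F].

Lemma in_rev F x y : ((x, y) \in rev_edges F) = ((y, x) \in F).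
Proof. by rewrite inE. Qed.

Lemma conn_rev F x y : conn (rev_edges F) x y = conn F y x.
Proof.
suff cr G a b : conn G a b -> conn (rev_edges G) b a.
  apply/idP/idP => /cr //; apply: conn_sub.
  by apply/subsetP=> -[a b]; rewrite !inE.
move=> /connectP[p Gp ->]; elim: p a Gp => [|z p IHp] a /=.
  by rewrite conn0.
case/andP=> az /IHp bz; apply: conn_trans bz _.
by apply: conn1; rewrite inE.
Qed.

(** Suppose that the edges differ and that F leads from u to u'.  Then every path
from c to u passes (x',u'), as otherwise u' could be reached without this edge;
so u' leads to u in E, and F leads from u' to u as well.  Whichever of the two
edges is met first on the way from c, its head now leads by F to the head of the
other one, without passing that other edge. *)
Lemma same_critical_edge F E c x u x' u' :
    F \subset E -> (x, u) \in E :\: F -> (x', u') \in E :\: F ->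
    conn E c u -> conn E c u' ->
    ~~ conn (E :\ (x, u)) c u -> ~~ conn (E :\ (x', u')) c u' ->
    conn F u u' \/ conn F u' u ->
    (conn E u u' -> conn E u' u -> conn F u u' /\ conn F u' u) ->
  (x, u) = (x', u').
Proof.
move=> sFE + + + + + + uu'.
wlog {uu'} uu' : x u x' u' / conn F u u'.
  move=> wl; case: uu' => uu'; first exact: wl.
  move=> *; apply/esym/wl => // => [u'u u_u']; apply/and_comm; auto.
move=> hE hE' cu cu' ncu ncu' back.
have FE h p q : h \in E :\: F -> conn F p q -> conn (E :\ h) p q.
  rewrite inE => /andP[nhF _]; apply: conn_sub.
  by apply/subsetP => e eF; rewrite !inE (subsetP sFE)// andbT;
     apply: contraNneq nhF => <-.
have [//|nhh'] := eqVneq (x, u) (x', u').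
have sE := conn_sub (subD1set E _).
case: (conn_split (x', u') cu) => [cu1|[/= cx' u'u]].
  by case/negP: ncu'; apply: conn_trans cu1 (FE _ _ _ hE' uu').
have [_ {}u'u] := back (conn_sub sFE uu') (sE _ _ _ u'u).
have step1 G e p : e \in E -> e != G -> conn (E :\ G) p e.1 ->
    conn (E :\ G) p e.2.
  move=> eE neG pe; apply: conn_trans pe (conn1 _).
  by rewrite !inE -surjective_pairing neG.
have hEE : (x, u) \in E by case/setDP: hE.
have hEE' : (x', u') \in E by case/setDP: hE'.
have sub2 G G' : (E :\ G) :\ G' \subset E :\ G' by apply: setSD; apply: subD1set.
case: (conn_split (x, u) cx') => [c1|[/= c1 _]].
- have /(step1 _ _ _ hEE') /= := conn_sub (sub2 _ _) c1.
  rewrite eq_sym => /(_ nhh') c2.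
  by case/negP: ncu; apply: conn_trans c2 (FE _ _ _ hE u'u).
have /(step1 _ _ _ hEE nhh') /= c2 := conn_sub (subD1set _ _) c1.
by case/negP: ncu'; apply: conn_trans c2 (FE _ _ _ hE' uu').
Qed.

(** * Simple paths *)

Definition step (l : seq V) x y := (y \in l) && (index y l == (index x l).+1).

Definition edges_of (l : seq V) : {set V * V} := [set e | step l e.1 e.2].

(** A simple path from x to y, listed with both ends; positions on it are read
off by index, and next and prev follow it except across the ends. *)
Definition spath F x y (l : seq V) :=
  [/\ uniq l, index x l = 0, (index y l).+1 = size l & edges_of l \subset F].

Lemma step_mem l x y : step l x y -> x \in l /\ y \in l.
Proof.
case/andP=> yl /eqP xy; split=> //; rewrite -index_mem.
by move: yl; rewrite -index_mem xy => /ltnW.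
Qed.

Lemma next_step l x : uniq l -> x \in l -> (index x l).+1 != size l ->
  step l x (next l x).
Proof.
move=> Ul xl; have := xl; rewrite -index_mem => xs nxs.
have xs1 : (index x l).+1 < size l by lia.
rewrite /step mem_next xl next_nth xl.
case: l Ul xl xs nxs xs1 => [//|a l] Ul xl xs nxs xs1.
by rewrite andTb -[nth _ l _]/(nth a (a :: l) (index x (a :: l)).+1) index_uniq.
Qed.

Lemma step_next l x y : uniq l -> step l x y -> next l x = y.
Proof.
move=> Ul xy; have [xl yl] := step_mem xy; case/andP: xy => _ /eqP xy.
have [_ /eqP nx] : next l x \in l /\ index (next l x) l == (index x l).+1.
  apply/andP/next_step => //.
  by move: yl; rewrite -index_mem xy; lia.
by apply: (index_inj x (s := l)); rewrite ?mem_next //= nx xy.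
Qed.

Lemma step_prev l x y : uniq l -> step l x y -> prev l y = x.
Proof. by move=> Ul /(step_next Ul) <-; rewrite prev_next. Qed.

Lemma prev_step l y : uniq l -> y \in l -> index y l != 0 ->
  step l (prev l y) y.
Proof.
move=> Ul yl ny0; have xy := next_prev Ul y.
have xl : prev l y \in l by rewrite mem_prev.
move: (prev l y) xy xl => x xy xl; rewrite -xy in yl ny0 *.
apply: next_step => //; apply: contraNneq ny0 => x_last.
case: l Ul xl x_last yl xy => [//|a l] Ul xl x_last yl xy.
by rewrite next_nth xl nth_default /= ?eqxx //; case: x_last => ->.
Qed.

Lemma spath_mem F x y l : spath F x y l -> x \in l /\ y \in l.
Proof. by case=> _ x0 y0 _; rewrite -!index_mem -y0 x0. Qed.

Lemma spath_edge F x y l a b : spath F x y l -> step l a b -> (a, b) \in F.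
Proof. by case=> _ _ _ /subsetP sF ab; apply: sF; rewrite inE. Qed.

Lemma conn_along F l u v : uniq l -> u \in l -> v \in l ->
    index u l <= index v l ->
    (forall x y, step l x y -> index u l <= index x l ->
       index y l <= index v l -> (x, y) \in F) ->
  conn F u v.
Proof.
move=> Ul ul vl; move: {2}(index v l - index u l) (leqnn (index v l - index u l)).
move=> n; elim: n u ul => [|n IHn] u ul n_uv le_uv ok.
  by have -> : u = v; [apply: (index_inj u ul vl); lia | apply: conn0].
have [->|nuv] := eqVneq u v; first exact: conn0.
have lt_uv : index u l < index v l.
  by rewrite ltn_neqAle le_uv andbT; apply: contraNneq nuv => /(index_inj u ul vl)->.
have su : step l u (next l u).
  by apply: next_step => //; move: vl; rewrite -index_mem; lia.
have [_ /eqP iu] := andP su.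
have nu : conn F u (next l u) by apply: conn1; apply: ok; rewrite ?iu.
apply: conn_trans nu (IHn (next l u) _ _ _ _); rewrite ?mem_next ?iu //; try lia.
by move=> x y xy ux; apply: ok => //; lia.
Qed.

Lemma spath_exists F x y : conn F x y -> exists l, spath F x y l.
Proof.
case/connectP=> p0 Fp0 ->; case/shortenP: Fp0 => p Fp Up _.
exists (x :: p); split=> //; first exact: index_head.
  by rewrite index_last.
apply/subsetP=> -[a b]; rewrite inE /= => /andP[bl /eqP ab].
have lt_ap : index a (x :: p) < size p by rewrite -ltnS -ab index_mem.
have /(pathP x)/(_ _ lt_ap) := Fp.
rewrite nth_index; last by rewrite -index_mem; apply: leqW.
by rewrite -[nth x p _]/(nth x (x :: p) _.+1) -ab nth_index.
Qed.

End Reachability.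

(** * Shortest networks and exchanges of edges *)
Section Shortest.
Variables (R : realDomainType) (V : finType) (d : V -> V -> R).
Hypothesis dC : forall x y, d x y = d y x.
Hypothesis d_ge0 : forall x y, (0 <= d x y)%R.
Hypothesis d_gt0 : forall x y, x != y -> (0 < d x y)%R.
Implicit Types (A B : {set V}) (E F D N : {set V * V}).

Definition len F : R := (\sum_(e in F) d e.1 e.2)%R.

Definition joins A B F := forall a b, a \in A -> b \in B -> conn F a b.

Definition shortest A B E :=
  joins A B E /\ forall F, joins A B F -> (len E <= len F)%R.

Lemma len_rev F : len (rev_edges F) = len F.
Proof.
rewrite /len (reindex_inj (h := fun e : V * V => (e.2, e.1))) /=; last first.
  by move=> [a b] [a' b'] [-> ->].
by apply: eq_big => [[a b]|[a b] _]; rewrite ?inE //= dC.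
Qed.

Lemma joins_rev A B F : joins A B F -> joins B A (rev_edges F).
Proof. by move=> jF b a bB aA; rewrite conn_rev; apply: jF. Qed.

Lemma shortest_rev A B E : shortest A B E -> shortest B A (rev_edges E).
Proof.
case=> jE mE; split; first exact: joins_rev.
by move=> F /joins_rev/mE; rewrite !len_rev.
Qed.

Lemma len_setU F D : (len (F :|: D) <= len F + len D)%R.
Proof.
rewrite /len (big_setID F) /= setIC setUC setKU setDUl setDv setU0.
rewrite lerD2l [leRHS](big_setID F) /= lerDr.
by apply: sumr_ge0 => e _; apply: d_ge0.
Qed.

Lemma len_setD E D : D \subset E -> len (E :\: D) = (len E - len D)%R.
Proof.
move=> sDE; rewrite /len [in RHS](big_setID D) /= (setIidPr sDE).
by rewrite [RHS]addrC addKr.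
Qed.

(** An exchange that keeps A connected to B does not pay. *)
Lemma exchange A B E D N : shortest A B E -> D \subset E ->
  joins A B (E :\: D :|: N) -> (len D <= len N)%R.
Proof.
case=> _ mE sDE /mE/le_trans/(_ (len_setU _ _)).
by rewrite len_setD // -addrA lerDl addrC subr_ge0.
Qed.

Lemma len1 e : len [set e] = d e.1 e.2.
Proof. by rewrite /len big_set1. Qed.

Lemma len0 : len set0 = 0%R.
Proof. by rewrite /len big_set0. Qed.

Lemma lenU1 e F : e \notin F -> len (e |: F) = (d e.1 e.2 + len F)%R.
Proof. by move=> eF; rewrite /len big_setU1. Qed.

Section Essential.
Variables (A B : {set V}) (E : {set V * V}).
Hypothesis shE : shortest A B E.
Hypothesis loopless : forall x y, (x, y) \in E -> x != y.

Lemma critical x y : (x, y) \in E ->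
  exists a b, [/\ a \in A, b \in B & ~~ conn (E :\ (x, y)) a b].
Proof.
move=> xyE; have [/exists_inP[a aA /exists_inP[b bB ab]]|/negbTE nab] :=
    boolP [exists a in A, exists b in B, ~~ conn (E :\ (x, y)) a b].
  by exists a, b.
have : (len [set (x, y)] <= len set0)%R.
  apply: (exchange shE); first by rewrite sub1set.
  rewrite setU0 => a b aA bB; apply: contraFT nab => ab.
  by apply/exists_inP; exists a => //; apply/exists_inP; exists b.
by rewrite len0 len1 /= leNgt d_gt0 // loopless.
Qed.

(** An edge with a bypass could be deleted. *)
Lemma essential x y : (x, y) \in E -> ~~ conn (E :\ (x, y)) x y.
Proof.
move=> xyE; have [a [b [aA bB]]] := critical xyE; apply: contra => xy.
apply: (@conn_retract _ E _ id) (shE.1 a b aA bB) => p q pq.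
have [[-> ->] //|npq] := eqVneq (p, q) (x, y).
by apply: conn1; rewrite !inE npq.
Qed.

End Essential.

(** Rewiring at a step (b,c) shared by two opposite paths that read x,b,c,y and
z,b,c,w.  The vertex c becomes isolated.  Walks are saved by moving c to b, y to
z and w to x: a walk that came out of c at y or w could only proceed to z or
x. *)
Lemma exchange_joins A B E b c x y z w (D := [set (b, c); (c, y); (c, w)])
    (N := [set (b, z); (b, x)]) :
    (forall p, (p, c) \in E -> p = b) ->
    (forall q, (c, q) \in E -> q = y \/ q = w) ->
    y = z \/ (y, z) \in E /\ (forall q, (y, q) \in E -> q = z) ->
    w = x \/ (w, x) \in E /\ (forall q, (w, q) \in E -> q = x) ->
    uniq [:: b; c; y; w] -> z \notin [:: b; c; w] -> x \notin [:: b; c; y] ->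
    [disjoint [:: c; y; w] & A :|: B] ->
  joins A B E -> joins A B (E :\: D :|: N).
Proof.
move=> inc outc Hy Hw; rewrite /= !inE !negb_or -!andbA.
case/and5P=> nbc nby nbw ncy /and3P[ncw nyw _] /and3P[nzb nzc nzw].
case/and3P=> nxb nxc nxy /pred0P dis jE.
pose phi u := if u == c then b else if u == y then z else if u == w then x else u.
have phiT u : u \in A :|: B -> phi u = u.
  move=> uT; move: (dis u); rewrite !inE -in_setU uT andbT => /norP[uc /norP[uy uw]].
  by rewrite /phi (negbTE uc) (negbTE uy) (negbTE uw).
move=> a b' aA bB; rewrite -[a]phiT ?inE ?aA // -[b']phiT ?inE ?bB ?orbT //.
apply: conn_retract (jE a b' aA bB) => p q pq.
set E' := _ :|: _.
have phic : phi c = b by rewrite /phi eqxx.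
have phiy : phi y = z by rewrite /phi eqxx eq_sym (negbTE ncy).
have phiw : phi w = x.
  by rewrite /phi eqxx eq_sym (negbTE ncw) eq_sym (negbTE nyw).
have phib : phi b = b by rewrite /phi (negbTE nbc) (negbTE nby) (negbTE nbw).
have phiz : phi z = z.
  by rewrite /phi (negbTE nzc) (negbTE nzw); case: eqP => [->|].
have phix : phi x = x.
  by rewrite /phi (negbTE nxc) (negbTE nxy); case: eqP => [->|].
have [qc|nqc] := eqVneq q c.
  by move: pq; rewrite qc => /inc ->; rewrite phic phib; apply: conn0.
have [pc|npc] := eqVneq p c.
  move: pq; rewrite pc => /outc [] ->; rewrite phic ?phiy ?phiw; apply: conn1;
  by rewrite !inE !eqxx ?orbT.
have kept r u : (r, u) \in E -> r != c -> u != c -> conn E' r u.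
  move=> ruE nrc nuc; apply: conn1; rewrite !inE !xpair_eqE ruE.
  by rewrite (negbTE nuc) (negbTE nrc) !andbF.
have toz : conn E' y z.
  case: Hy => [->|[yz _]]; [exact: conn0 | apply: kept; rewrite // eq_sym //].
have tox : conn E' w x.
  case: Hw => [->|[wx _]]; [exact: conn0 | apply: kept; rewrite // eq_sym //].
have toq : conn E' q (phi q).
  rewrite /phi (negbTE nqc); case: eqVneq => [->//|_].
  by case: eqVneq => [->//|_]; apply: conn0.
have pq' := conn_trans (kept _ _ pq npc nqc) toq.
have [py|npy] := eqVneq p y.
  rewrite py in pq pq' *; case: Hy => [yz|[_ /(_ q pq) ->]].
    by rewrite {1}yz phiz -yz.
  by rewrite phiy phiz; apply: conn0.
have [pw|npw] := eqVneq p w.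
  rewrite pw in pq pq' *; case: Hw => [wx|[_ /(_ q pq) ->]].
    by rewrite {1}wx phix -wx.
  by rewrite phiw phix; apply: conn0.
by rewrite {1}/phi (negbTE npc) (negbTE npy) (negbTE npw).
Qed.

Lemma exchange_len A B E b c x y z w :
    shortest A B E -> (b, c) \in E -> (c, y) \in E -> (c, w) \in E ->
    (forall p, (p, c) \in E -> p = b) ->
    (forall q, (c, q) \in E -> q = y \/ q = w) ->
    y = z \/ (y, z) \in E /\ (forall q, (y, q) \in E -> q = z) ->
    w = x \/ (w, x) \in E /\ (forall q, (w, q) \in E -> q = x) ->
    uniq [:: b; c; y; w] -> z \notin [:: b; c; w] -> x \notin [:: b; c; y] ->
    [disjoint [:: c; y; w] & A :|: B] ->
  (d b c + d c y + d c w <= d b z + d b x)%R.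
Proof.
move=> shE bcE cyE cwE inc outc Hy Hw U zn xn dis.
have sDE : [set (b, c); (c, y); (c, w)] \subset E.
  by apply/subsetP=> e; rewrite !inE -orbA => /or3P[]/eqP->.
have jE := exchange_joins inc outc Hy Hw U zn xn dis shE.1.
have := le_trans (exchange shE sDE jE) (len_setU _ _).
move: U; rewrite /= !inE !negb_or -!andbA.
case/and5P=> nbc nby nbw ncy /and3P[ncw nyw _].
rewrite -setUA !lenU1 ?len1 /= ?inE ?xpair_eqE ?negb_or ?negb_and ?nbc ?nyw ?orbT //.
lra.
Qed.

End Shortest.

(** * Two opposite paths *)
Section Ladder.
Variables (R : realDomainType) (V : finType) (d : V -> V -> R).
Hypothesis dC : forall x y, d x y = d y x.
Hypothesis d_ge0 : forall x y, (0 <= d x y)%R.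
Hypothesis d_gt0 : forall x y, x != y -> (0 < d x y)%R.
Variables (A B : {set V}) (E : {set V * V}).
Hypothesis shE : shortest d A B E.
Hypothesis loopless : forall x y, (x, y) \in E -> x != y.

Definition nbrs v : {set V} :=
  [set w | (w != v) && (((v, w) \in E) || ((w, v) \in E))].

(** Two simple paths in opposite directions, and a set M of marked vertices away
from which P and Q carry the whole network.  The conditions are symmetric under
swapping P with Q and s with t, which halves the case analysis below. *)
Record antiparallel s t (P Q : seq V) (M : {set V}) : Prop := Antiparallel {
  ap_P : spath E s t P;
  ap_Q : spath E t s Q;
  ap_s : s \in M;
  ap_t : t \in M;
  ap_in : forall v u, v \in P ++ Q -> v \notin M -> (u, v) \in E ->
    step P u v || step Q u v;
  ap_out : forall v u, v \in P ++ Q -> v \notin M -> (v, u) \in E ->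
    step P v u || step Q v u;
  ap_deg : forall v, v \in P ++ Q -> v \notin M -> 3 <= #|nbrs v|;
  ap_steiner : forall v, v \in P ++ Q -> v \notin M -> v \notin A :|: B }.

Lemma antiparallel_sym s t P Q M :
  antiparallel s t P Q M -> antiparallel t s Q P M.
Proof.
case=> *; split; rewrite // => v; rewrite mem_cat orbC -mem_cat; auto;
by move=> u *; rewrite orbC; auto.
Qed.

Lemma path_degree l v : uniq l ->
    (forall u, (u, v) \in E -> step l u v) ->
    (forall u, (v, u) \in E -> step l v u) ->
  #|nbrs v| <= 2.
Proof.
move=> Ul inl outl; apply: (@leq_trans #|[set prev l v; next l v]|); last first.
  by rewrite cards2; case: eqP.
apply/subset_leq_card/subsetP=> w; rewrite !inE => /andP[_].
by case/orP=> [/outl/(step_next Ul)|/inl/(step_prev Ul)] ->; rewrite eqxx ?orbT.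
Qed.

(** On P alone, v would have only its two neighbours along P. *)
Lemma unmarked_mem s t P Q M v : antiparallel s t P Q M ->
  v \in P -> v \notin M -> v \in Q.
Proof.
move=> ap vP vM; have vPQ : v \in P ++ Q by rewrite mem_cat vP.
have [UP _ _ _] := ap_P ap; apply: contraLR (ap_deg ap vPQ vM) => vQ.
rewrite -leqNgt; apply: (path_degree UP) => u uv.
  by case/orP: (ap_in ap vPQ vM uv) => // /step_mem[_]; rewrite (negbTE vQ).
by case/orP: (ap_out ap vPQ vM uv) => // /step_mem[]; rewrite (negbTE vQ).
Qed.

Lemma unmarked_steps s t P Q M v : antiparallel s t P Q M ->
    v \in P -> v \notin M ->
  step P (prev P v) v /\ step P v (next P v).
Proof.
move=> ap vP vM; have [UP s0 t0 _] := ap_P ap; have [sP tP] := spath_mem (ap_P ap).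
split.
  apply: prev_step => //; rewrite -s0; apply: contraNneq vM.
  by move/(index_inj s vP sP) ->; apply: ap_s ap.
apply: next_step => //; rewrite -t0; apply: contraNneq vM => -[].
by move/(index_inj s vP tP) ->; apply: ap_t ap.
Qed.

Lemma unmarked_nbrs s t P Q M v p q : antiparallel s t P Q M ->
    v \in P -> v \notin M ->
    prev P v \in [set p; q] -> next P v \in [set p; q] ->
    prev Q v \in [set p; q] -> next Q v \in [set p; q] -> False.
Proof.
move=> ap vP vM pP nP pQ nQ; have vPQ : v \in P ++ Q by rewrite mem_cat vP.
have [UP _ _ _] := ap_P ap; have [UQ _ _ _] := ap_Q ap.
have le2 : #|[set p; q]| <= 2 by rewrite cards2; case: eqP.
suff : #|nbrs v| <= #|[set p; q]| 
  by move=> /leq_trans/(_ le2); rewrite leqNgt (ap_deg ap vPQ vM).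
apply/subset_leq_card/subsetP=> w; rewrite inE => /andP[_].
case/orP=> [/(ap_out ap vPQ vM)|/(ap_in ap vPQ vM)] /orP[] => [
  /(step_next UP)|/(step_next UQ)|/(step_prev UP)|/(step_prev UQ)];
by move=> <-.
Qed.

(* The goals that follow are linear in path positions; membership facts would
   only multiply the cases. *)
Ltac index_lia :=
  repeat match goal with
  | H : is_true (_ \in _) |- _ => clear H
  | H : is_true (_ \notin _) |- _ => clear H
  | H : is_true (step _ _ _) |- _ => clear H
  | H : is_true (~~ step _ _ _) |- _ => clear H
  | H : is_true (uniq _) |- _ => clear H
  | H : antiparallel _ _ _ _ _ |- _ => clear H
  | x := _ |- _ => clearbody x
  end; lia.

(** Suppose that Q visits u no later than x and that u is not after y on P.  Then
the edge (x,y) has a bypass: follow P from x to its end t, then Q from its start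
t to u, then P from u to y.  The second claim is the mirror image, through the
end s of Q. *)
Lemma records s t P Q M x y u : antiparallel s t P Q M ->
    step Q x y -> ~~ step P x y -> x \in P -> y \in P -> u \in P -> u \in Q ->
  (index u Q <= index x Q -> index y P < index u P) /\
  (index y Q <= index u Q -> index u P < index x P).
Proof.
move=> ap Qxy nPxy xP yP uP uQ; have [xQ yQ] := step_mem Qxy.
have [UP s0 t0 _] := ap_P ap; have [sP tP] := spath_mem (ap_P ap).
have [UQ t0' s0' _] := ap_Q ap; have [tQ sQ] := spath_mem (ap_Q ap).
have xyE := spath_edge (ap_Q ap) Qxy.
have /negP ess := essential d_ge0 d_gt0 shE loopless xyE.
have alongP p q : p \in P -> q \in P -> index p P <= index q P ->
    conn (E :\ (x, y)) p q.
  move=> pP qP pq; apply: (conn_along UP pP qP pq) => a b Pab _ _.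
  rewrite !inE (spath_edge (ap_P ap) Pab) andbT.
  by apply: contraNneq nPxy => -[<- <-].
have alongQ p q : p \in Q -> q \in Q -> index p Q <= index q Q ->
    index q Q <= index x Q \/ index y Q <= index p Q -> conn (E :\ (x, y)) p q.
  move=> pQ qQ pq avoid; apply: (conn_along UQ pQ qQ pq) => a b Qab pa bq.
  rewrite !inE (spath_edge (ap_Q ap) Qab) andbT.
  apply: contraPneq avoid => -[ax bx]; move: Qab pa bq; rewrite ax bx.
  by move=> /andP[_ /eqP ->] pa bq [|]; index_lia.
have bt a : a \in P -> index a P <= index t P.
  by rewrite -index_mem -t0.
have bs a : a \in Q -> index a Q <= index s Q.
  by rewrite -index_mem -s0'.
split=> ux; rewrite ltnNge; apply/negP => le; apply: ess.
  apply: conn_trans (alongP x t _ _ (bt _ xP)) _ => //.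
  apply: conn_trans (alongP u y _ _ le) => //.
  by apply: alongQ; rewrite ?t0' //; left.
apply: conn_trans (alongP x u _ _ le) _ => //.
apply: conn_trans (alongP s y _ _ _); rewrite ?s0 //.
by apply: alongQ; rewrite ?bs //; right.
Qed.

Lemma step_index (l : seq V) x y : step l x y -> index y l = (index x l).+1.
Proof. by case/andP=> _ /eqP. Qed.

(** Here P and Q run together from b to c, with c = b allowed; x precedes b on P,
and w follows c on Q.  By records for the edges into b and out of c, Q visits x
after c, and w is not after x on P.  From w onwards Q cannot jump back on P,
since records would put x before the point of departure; so Q follows P forward
until it reaches x.  Two such forward steps in a row would leave their common
vertex with two neighbours, so w is x or its predecessor. *)
Lemma turn s t P Q M b c : antiparallel s t P Q M -> b \in P -> c \in P ->
    b = c \/ step P b c /\ step Q b c ->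
    prev P b != prev Q b -> next P c != next Q c ->
    [disjoint [:: b; c; prev P b; prev Q b; next Q c; next Q (next Q c);
                  next Q (next Q (next Q c))] & M] ->
  next Q c = prev P b \/ step P (next Q c) (prev P b) /\
                         step Q (next Q c) (prev P b).
Proof.
move=> ap bP cP bc nxz nyw /pred0P dis.
have nM u : u \in [:: b; c; prev P b; prev Q b; next Q c; next Q (next Q c);
                  next Q (next Q (next Q c))] -> u \notin M.
  by move=> ul; have := dis u; rewrite /= ul /= => ->.
have ap' := antiparallel_sym ap.
have toQ u : u \in P -> u \notin M -> u \in Q := unmarked_mem ap.
have toP u : u \in Q -> u \notin M -> u \in P := unmarked_mem ap'.
have [UP _ _ _] := ap_P ap; have [UQ _ _ _] := ap_Q ap.
have bM : b \notin M by apply: nM; rewrite !inE eqxx.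
have cM : c \notin M by apply: nM; rewrite !inE eqxx ?orbT.
have bQ := toQ b bP bM; have cQ := toQ c cP cM.
have [Pxb _] := unmarked_steps ap bP bM.
have [Qzb _] := unmarked_steps ap' bQ bM.
have [_ Pcy] := unmarked_steps ap cP cM.
have [_ Qcw] := unmarked_steps ap' cQ cM.
set x := prev P b in nM Pxb nxz *; set z := prev Q b in nM Qzb nxz.
set w := next Q c in nM nyw Qcw *; set w' := next Q w in nM.
set w'' := next Q w' in nM.
have xM : x \notin M by apply: nM; rewrite !inE eqxx ?orbT.
have zM : z \notin M by apply: nM; rewrite !inE eqxx ?orbT.
have wM : w \notin M by apply: nM; rewrite !inE eqxx ?orbT.
have w'M : w' \notin M by apply: nM; rewrite !inE eqxx ?orbT.
have w''M : w'' \notin M by apply: nM; rewrite !inE eqxx ?orbT.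
have xP : x \in P by case: (step_mem Pxb).
have zQ : z \in Q by case: (step_mem Qzb).
have wQ : w \in Q by rewrite mem_next.
have w'Q : w' \in Q by rewrite mem_next.
have w''Q : w'' \in Q by rewrite mem_next.
have [zP wP w'P w''P] := And4 (toP z zQ zM) (toP w wQ wM) (toP w' w'Q w'M)
  (toP w'' w''Q w''M).
have xQ := toQ x xP xM.
have [_ Qww'] : step Q (prev Q w) w /\ step Q w w' := unmarked_steps ap' wQ wM.
have [_ Qw'w''] : step Q (prev Q w') w' /\ step Q w' w'' :=
  unmarked_steps ap' w'Q w'M.
have nPzb : ~~ step P z b.
  by apply: contraNN nxz => /(step_prev UP) zE; rewrite /x zE.
have nPcw : ~~ step P c w.
  by apply: contraNN nyw => /(step_next UP) ->.
(* On a simple path, vertices are determined by their positions. *)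
have eqP' := fun u v (uP : u \in P) (vP : v \in P) => @index_inj _ s P u v uP vP.
have eqQ' := fun u v (uQ : u \in Q) (vQ : v \in Q) => @index_inj _ s Q u v uQ vQ.
have [r1 _] := records ap Qzb nPzb zP bP xP xQ.
have [r2 _] := records ap Qcw nPcw cP wP cP cQ.
have iPxb := step_index Pxb; have iQzb := step_index Qzb.
have iQcw := step_index Qcw.
have xw : index w Q <= index x Q.
  have neb : index x Q != index b Q.
    by apply: contraTneq Pxb => /(eqQ' _ _ xQ bQ) ->; rewrite /step; index_lia.
  case: bc => [bc|[/step_index iPbc /step_index iQbc]].
    by rewrite bc in neb iQzb iPxb r1 *; index_lia.
  have : index x Q != index c Q.
    by apply/eqP => /(eqQ' _ _ xQ cQ) E1; rewrite E1 in iPxb; index_lia.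
  index_lia.
have wx : index w P <= index x P.
  case: bc => [bc|[/step_index iPbc /step_index iQbc]].
    by rewrite bc in iPxb *; index_lia.
  have : index w P != index b P.
    by apply/eqP => /(eqP' _ _ wP bP) E1; rewrite E1 in iQcw; index_lia.
  index_lia.
have [->|nwx] := eqVneq w x; first by left.
have iQww' := step_index Qww'; have iQw'w'' := step_index Qw'w''.
have nwxQ : index w Q != index x Q.
  by apply: contraNneq nwx => /(eqQ' _ _ wQ xQ) ->.
have Pww' : step P w w'.
  apply/negPn/negP => nPww'.
  by have [_] := records ap Qww' nPww' wP w'P xP xQ; index_lia.
have iPww' := step_index Pww'.
have [w'x|nw'x] := eqVneq w' x; first by right; rewrite -w'x.
have nw'xQ : index w' Q != index x Q.
  by apply: contraNneq nw'x => /(eqQ' _ _ w'Q xQ) ->.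
have nwxP : index w P != index x P.
  by apply: contraNneq nwx => /(eqP' _ _ wP xP) ->.
have [Pw'w''|nPw'w''] := boolP (step P w' w'').
  case: (unmarked_nbrs (p := w) (q := w'') ap w'P w'M); rewrite !inE.
  - by rewrite (step_prev UP Pww') eqxx.
  - by rewrite (step_next UP Pw'w'') eqxx orbT.
  - by rewrite (step_prev UQ Qww') eqxx.
  - by rewrite eqxx orbT.
by have [_] := records ap Qw'w'' nPw'w'' w'P w''P xP xQ; index_lia.
Qed.

(** The vertices near v are collected by walking along P and Q in both
directions; next and prev being inverse to each other makes this symmetric. *)
Definition nbhd (P Q : seq V) v := [:: v; next P v; prev P v; next Q v; prev Q v].

Fixpoint vicinity P Q k v :=
  if k is k'.+1 then flatten [seq vicinity P Q k' u | u <- nbhd P Q v] else [:: v].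

Definition far P Q (M : {set V}) k v := all [pred u | u \notin M] (vicinity P Q k v).

Lemma farS P Q M k v u : far P Q M k.+1 v -> u \in nbhd P Q v -> far P Q M k u.
Proof.
move=> /allP farv uv; apply/allP=> p pu; apply: farv.
by apply/flattenP; exists (vicinity P Q k u) => //; apply: map_f.
Qed.

Lemma far_notin P Q M k v : far P Q M k v -> v \notin M.
Proof.
elim: k v => [|k IHk] v; first by rewrite /far /= andbT.
by move=> /farS farv; apply: IHk; apply: farv; rewrite inE eqxx.
Qed.

Lemma far_sym P Q M k v : far P Q M k v -> far Q P M k v.
Proof.
have sw k' u : {subset vicinity Q P k' u <= vicinity P Q k' u}.
  elim: k' u => [|k' IHk] u //= p; rewrite !cats0 !mem_cat.
  by case/or4P=> [||/IHk ->|]; rewrite ?mem_cat; do ?[case/orP];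
     do ?[move/IHk ->]; rewrite ?orbT.
by move=> /allP farv; apply/allP=> u /sw /farv.
Qed.

Lemma far_trail P Q M v : far P Q M 3 v ->
  [/\ next Q v \notin M, next Q (next Q v) \notin M &
      next Q (next Q (next Q v)) \notin M].
Proof.
have nb u : next Q u \in nbhd P Q u by rewrite !inE eqxx !orbT.
move=> f3; have f2 := farS f3 (nb _); have f1 := farS f2 (nb _).
by have f0 := farS f1 (nb _); split; [move: f2|move: f1|move: f0];
   apply: far_notin.
Qed.

Lemma turn_far s t P Q M b c : antiparallel s t P Q M -> b \in P -> c \in P ->
    b = c \/ step P b c /\ step Q b c ->
    prev P b != prev Q b -> next P c != next Q c ->
    far P Q M 3 b -> far P Q M 3 c ->
  next Q c = prev P b \/ step P (next Q c) (prev P b) /\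
                         step Q (next Q c) (prev P b).
Proof.
move=> ap bP cP bc nxz nyw fb fc; apply: (turn ap bP cP bc nxz nyw).
have [c1 c2 c3] := far_trail fc.
have pP : prev P b \notin M.
  by apply: (@far_notin P Q M 2); apply: farS fb _; rewrite !inE eqxx !orbT.
have pQ : prev Q b \notin M.
  by apply: (@far_notin P Q M 2); apply: farS fb _; rewrite !inE eqxx !orbT.
have bM := far_notin fb; have cM := far_notin fc.
apply/pred0P=> u /=; apply/negP=> /andP[ul uM]; move: uM; apply/negP.
by move: ul; rewrite !inE; do 6?[case/orP]; move/eqP->.
Qed.

(** The only place where lengths matter.  The two rewirings of the ladder at
(b,c) are mirror images under reversal of all edges; each changes the total
length by at least 0, and the two changes add up to -2d(b,c). *)
Lemma no_shared_step s t P Q M b c : antiparallel s t P Q M ->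
  step P b c -> step Q b c -> far P Q M 3 b -> far P Q M 3 c -> False.
Proof.
move=> ap Pbc Qbc fb fc; have ap' := antiparallel_sym ap.
have [bP cP] := step_mem Pbc; have [bQ cQ] := step_mem Qbc.
have bM := far_notin fb; have cM := far_notin fc.
have [UP _ _ _] := ap_P ap; have [UQ _ _ _] := ap_Q ap.
have [Pxb _] := unmarked_steps ap bP bM; have [_ Pcy] := unmarked_steps ap cP cM.
have [Qzb _] := unmarked_steps ap' bQ bM; have [_ Qcw] := unmarked_steps ap' cQ cM.
have nxz : prev P b != prev Q b.
  apply/eqP=> xz; apply: (unmarked_nbrs (p := prev P b) (q := c) ap bP bM);
  by rewrite ?(step_next UP Pbc) ?(step_next UQ Qbc) -?xz !inE eqxx ?orbT.
have nyw : next P c != next Q c.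
  apply/eqP=> yw; apply: (unmarked_nbrs (p := next P c) (q := b) ap cP cM);
  by rewrite ?(step_prev UP Pbc) ?(step_prev UQ Qbc) -?yw !inE eqxx ?orbT.
have W := turn_far ap bP cP (or_intror (conj Pbc Qbc)) nxz nyw fb fc.
have Z := turn_far ap' bQ cQ (or_intror (conj Qbc Pbc)).
move: {Z}(Z); rewrite eq_sym => /(_ nxz); rewrite eq_sym => /(_ nyw).
move=> /(_ (far_sym fb) (far_sym fc)) Z.
have nb2 u v : far P Q M 3 u -> v \in nbhd P Q u -> v \notin M.
  by move=> fu vu; apply: (@far_notin P Q M 2); apply: farS fu vu.
have xM : prev P b \notin M by apply: nb2 fb _; rewrite !inE eqxx !orbT.
have zM : prev Q b \notin M by apply: nb2 fb _; rewrite !inE eqxx !orbT.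
have yM : next P c \notin M by apply: nb2 fc _; rewrite !inE eqxx !orbT.
have wM : next Q c \notin M by apply: nb2 fc _; rewrite !inE eqxx !orbT.
move: (prev P b) (prev Q b) (next P c) (next Q c) xM zM yM wM Pxb Qzb Pcy Qcw
  nxz nyw W Z => x z y w xM zM yM wM Pxb Qzb Pcy Qcw nxz nyw W Z.
have inPQ u v : step P u v \/ step Q u v -> u \in P ++ Q /\ v \in P ++ Q.
  by case=> /step_mem[]; rewrite !mem_cat => -> ->; rewrite ?orbT.
have [xPQ _] := inPQ _ _ (or_introl Pxb); have [zPQ _] := inPQ _ _ (or_intror Qzb).
have [cPQ yPQ] := inPQ _ _ (or_introl Pcy).
have [_ wPQ] := inPQ _ _ (or_intror Qcw); have [bPQ _] := inPQ _ _ (or_introl Pbc).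
have in_from u v p q : v \in P ++ Q -> v \notin M -> step P p v -> step Q q v ->
    (u, v) \in E -> u = p \/ u = q.
  move=> vPQ vM Ppv Qqv /(ap_in ap vPQ vM) /orP[]
    => [/(step_prev UP) <-|/(step_prev UQ) <-].
    by left; apply: step_prev UP Ppv.
  by right; apply: step_prev UQ Qqv.
have out_to u v p q : v \in P ++ Q -> v \notin M -> step P v p -> step Q v q ->
    (v, u) \in E -> u = p \/ u = q.
  move=> vPQ vM Ppv Qqv /(ap_out ap vPQ vM) /orP[]
    => [/(step_next UP) <-|/(step_next UQ) <-].
    by left; apply: step_next UP Ppv.
  by right; apply: step_next UQ Qqv.
have EP u v : step P u v -> (u, v) \in E := @spath_edge _ _ _ _ _ u v (ap_P ap).
have EQ u v : step Q u v -> (u, v) \in E := @spath_edge _ _ _ _ _ u v (ap_Q ap).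
have ixb := step_index Pxb; have ibc := step_index Pbc; have icy := step_index Pcy.
have jzb := step_index Qzb; have jbc := step_index Qbc; have jcw := step_index Qcw.
have nP u v : index u P < index v P -> u != v.
  by apply: contraTneq => ->; rewrite ltnn.
have nQ u v : index u Q < index v Q -> u != v.
  by apply: contraTneq => ->; rewrite ltnn.
have [nbc nby ncy] : [/\ b != c, b != y & c != y] by split; apply: nP;
  clear -ixb ibc icy; lia.
have [nbw ncw nzw] : [/\ b != w, c != w & z != w] by split; apply: nQ;
  clear -jzb jbc jcw; lia.
have [nzb nzc] : z != b /\ z != c by split; apply: nQ;
  clear -jzb jbc jcw; lia.
have [nxb nxc nxy] : [/\ x != b, x != c & x != y] by split; apply: nP;
  clear -ixb ibc icy; lia.
have noT p q r : [&& p \notin A :|: B, q \notin A :|: B & r \notin A :|: B] ->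
    [disjoint [:: p; q; r] & A :|: B].
  case/and3P=> np nq nr; apply/pred0P=> u /=; apply/negP=> /andP[ul uT].
  by move: ul uT; rewrite !inE => /or3P[]/eqP->; apply/negP; rewrite -in_setU.
have stn u : u \in P ++ Q -> u \notin M -> u \notin A :|: B.
  exact: ap_steiner ap u.
have one : (d b c + d c y + d c w <= d b z + d b x)%R.
  apply: (exchange_len d_ge0 shE (EP _ _ Pbc) (EP _ _ Pcy) (EQ _ _ Qcw)).
  - by move=> p /(in_from _ _ _ _ cPQ cM Pbc Qbc)[].
  - by move=> q /(out_to _ _ _ _ cPQ cM Pcy Qcw).
  - case: Z => [->|[Qyz Pyz]]; [by left|right; split; first exact: EP].
    by move=> q /(out_to _ _ _ _ yPQ yM Pyz Qyz)[].
  - case: W => [->|[Pwx Qwx]]; [by left|right; split; first exact: EP].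
    by move=> q /(out_to _ _ _ _ wPQ wM Pwx Qwx)[].
  - by rewrite /= !inE !negb_or nbc nby nbw ncy ncw nyw.
  - by rewrite !inE !negb_or nzb nzc nzw.
  - by rewrite !inE !negb_or nxb nxc nxy.
  - by apply: noT; rewrite !stn.
(* The second rewiring is the first one in the reversed network, where (c,b)
   takes the place of (b,c). *)
have two : (d c b + d b x + d b z <= d c w + d c y)%R.
  apply: (exchange_len d_ge0 (shortest_rev dC shE)).
  - by rewrite inE /=; apply: EP.
  - by rewrite inE /=; apply: EP.
  - by rewrite inE /=; apply: EQ.
  - by move=> p; rewrite inE => /(out_to _ _ _ _ bPQ bM Pbc Qbc)[].
  - by move=> q; rewrite inE => /(in_from _ _ _ _ bPQ bM Pxb Qzb).
  - case: W => [->|[Pwx Qwx]]; [by left|right; split; first by rewrite inE; apply: EP].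
    by move=> q; rewrite inE => /(in_from _ _ _ _ xPQ xM Pwx Qwx)[].
  - case: Z => [->|[Qyz Pyz]]; [by left|right; split; first by rewrite inE; apply: EP].
    by move=> q; rewrite inE => /(in_from _ _ _ _ zPQ zM Pyz Qyz)[].
  - by rewrite /= !inE !negb_or [c == b]eq_sym [b == x]eq_sym [b == z]eq_sym
      [c == x]eq_sym [c == z]eq_sym nbc nxb nzb nxc nzc nxz.
  - by rewrite !inE !negb_or ![w == _]eq_sym ncw nbw nzw.
  - by rewrite !inE !negb_or ![y == _]eq_sym ncy nby nxy.
  - by rewrite setUC; apply: noT; rewrite !stn.
have := d_gt0 nbc; rewrite (dC c b) in two; move: one two.
move: (d b c) (d c y) (d c w) (d b z) (d b x) => r1 r2 r3 r4 r5; lra.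
Qed.

(** If v is on a shared step, no_shared_step applies at v.  Otherwise turn, used
with b = c = v for (P,Q) and for (Q,P), either finds a shared step one step away
or says that the neighbours of v on Q are its neighbours on P. *)
Lemma marked_nearby s t P Q M v : antiparallel s t P Q M -> v \in P ++ Q ->
  has [in M] (vicinity P Q 4 v).
Proof.
move=> ap vPQ; apply/negPn/negP; rewrite -all_predC => fv.
have {}fv : far P Q M 4 v by apply: sub_all fv => u.
have ap' := antiparallel_sym ap; have vM := far_notin fv.
have [vP vQ] : v \in P /\ v \in Q.
  move: vPQ; rewrite mem_cat => /orP[vP|vQ]; split=> //.
    exact: unmarked_mem ap vP vM.
  exact: unmarked_mem ap' vQ vM.
have f3 u : u \in nbhd P Q v -> far P Q M 3 u := farS fv.
have fvv : far P Q M 3 v by apply: f3; rewrite inE eqxx.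
have fx : far P Q M 3 (prev P v) by apply: f3; rewrite !inE eqxx ?orbT.
have fz : far P Q M 3 (prev Q v) by apply: f3; rewrite !inE eqxx ?orbT.
have fy : far P Q M 3 (next P v) by apply: f3; rewrite !inE eqxx ?orbT.
have fw : far P Q M 3 (next Q v) by apply: f3; rewrite !inE eqxx ?orbT.
have [Pxv Pvy] := unmarked_steps ap vP vM.
have [Qzv Qvw] := unmarked_steps ap' vQ vM.
have [xz|nxz] := eqVneq (prev P v) (prev Q v).
  by rewrite -xz in Qzv; apply: no_shared_step ap Pxv Qzv fx fvv.
have [yw|nyw] := eqVneq (next P v) (next Q v).
  by rewrite -yw in Qvw; apply: no_shared_step ap Pvy Qvw fvv fy.
have [wx|[Pwx Qwx]] := turn_far ap vP vP (or_introl erefl) nxz nyw fvv fvv; last first.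
  exact: no_shared_step ap Pwx Qwx fw fx.
have sv := far_sym fvv; rewrite eq_sym in nxz; rewrite eq_sym in nyw.
have [yz|[Qyz Pyz]] := turn_far ap' vQ vQ (or_introl erefl) nxz nyw sv sv; last first.
  exact: no_shared_step ap Pyz Qyz fy fz.
apply: (unmarked_nbrs (p := prev P v) (q := next P v) ap vP vM);
by rewrite ?wx -?yz !inE eqxx ?orbT.
Qed.

Lemma nbhd_sym P Q u v : uniq P -> uniq Q -> u \in nbhd P Q v -> v \in nbhd P Q u.
Proof.
move=> UP UQ; rewrite !inE => /or4P[|||/orP[]] /eqP ->;
by rewrite ?prev_next ?next_prev ?eqxx ?orbT.
Qed.

Lemma vicinity_trans P Q k u v w :
  u \in vicinity P Q k v -> w \in nbhd P Q u -> w \in vicinity P Q k.+1 v.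
Proof.
elim: k v => [|k IHk] v.
  rewrite inE => /eqP -> wv; apply/flattenP; exists (vicinity P Q 0 w).
    exact: map_f wv.
  by rewrite inE.
move=> /flattenP[_ /mapP[p pv ->] up] wu; apply/flattenP.
by exists (vicinity P Q k.+1 p); [apply: map_f | apply: IHk up wu].
Qed.

Lemma vicinity_sym P Q k u v : uniq P -> uniq Q ->
  u \in vicinity P Q k v -> v \in vicinity P Q k u.
Proof.
move=> UP UQ; elim: k u v => [|k IHk] u v; first by rewrite !inE eq_sym.
move=> /flattenP[_ /mapP[p pv ->] /IHk pu].
exact: vicinity_trans pu (nbhd_sym UP UQ pv).
Qed.

End Ladder.

Arguments vicinity : simpl never.

(** * Counting Steiner points along a path *)

Lemma leq_card_rel (S T : finType) (X : {set S}) (Y : {set T}) (r : S -> T -> bool) :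
    (forall x, x \in X -> exists2 y, y \in Y & r x y) ->
    (forall x x' y, x \in X -> x' \in X -> r x y -> r x' y -> x = x') ->
  #|X| <= #|Y|.
Proof.
move=> tot inj; have [Y0|[y0 y0Y]] := set_0Vmem Y.
  rewrite Y0 cards0 leqn0 cards_eq0; apply/eqP/setP=> x; rewrite inE.
  by apply/negP=> /tot[y]; rewrite Y0 inE.
pose f x := odflt y0 [pick y in Y | r x y].
have fP x : x \in X -> f x \in Y /\ r x (f x).
  move=> xX; rewrite /f; case: pickP => [y /andP[]//|none].
  by have [y yY rxy] := tot x xX; have := none y; rewrite /= yY rxy.
rewrite -(@card_in_imset _ _ f); last first.
  move=> x x' xX x'X fxx'; have [_ rx] := fP x xX; have [_ rx'] := fP x' x'X.
  by apply: (inj x x' (f x)) => //; rewrite fxx'.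
by apply/subset_leq_card/subsetP=> _ /imsetP[x xX ->]; case: (fP x xX).
Qed.

Lemma leq_card_bigcup (S T : finType) (X : {set T}) (F : T -> {set S}) k :
  (forall x, x \in X -> #|F x| <= k) -> #|\bigcup_(x in X) F x| <= #|X| * k.
Proof.
move=> Fk; rewrite -sum_nat_const.
apply: leq_trans (_ : \sum_(x in X) #|F x| <= _); last exact: leq_sum.
elim/big_rec2: _ => [|x m U _ le]; first by rewrite cards0.
by apply: leq_trans (leq_card_setU _ _) _; rewrite leq_add2l.
Qed.

(** A predicate that is convex for the order of travel selects a contiguous part
of a path. *)
Lemma filter_convex (T : eqType) (r : rel T) (D : pred T) (l : seq T) :
    (forall x y z, D x -> r x y -> r y z -> D z -> D y) -> pairwise r l ->
  exists l0 l1, [/\ l = l0 ++ [seq x <- l | D x] ++ l1, ~~ has D l0 & ~~ has D l1].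
Proof.
move=> cvx; elim: l => [|x l IHl] /=; first by exists [::], [::].
case/andP=> rxl rl; have [l0 [l1 [El nD0 nD1]]] := IHl rl.
have [Dx|nDx] := boolP (D x); last first.
  by exists (x :: l0), l1; split; rewrite /= ?(negbTE nDx) //= {1}El.
rewrite /=; case Ef: [seq x <- l | D x] => [|z f].
  exists [::], l; split=> //.
  by rewrite seq.has_filter Ef.
have l00 : l0 = [::].
  case: l0 El nD0 => [//|y l0] El; rewrite /= negb_or => /andP[/negP[]].
  have Dz : D z.
    have : all D [seq x <- l | D x] by apply: filter_all.
    by rewrite Ef /= => /andP[].
  move: rxl rl; rewrite El Ef /= => /andP[rxy _] /andP[ry _].
  apply: cvx Dx rxy _ Dz; move: ry; rewrite all_cat => /andP[_] /=.
  by case/andP.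
exists [::], l1; split=> //=; congr (_ :: _).
by rewrite {1}El l00 Ef.
Qed.

Section Counting.
Variables (R : realDomainType) (V : finType) (d : V -> V -> R).
Hypothesis dC : forall x y, d x y = d y x.
Hypothesis d_ge0 : forall x y, (0 <= d x y)%R.
Hypothesis d_gt0 : forall x y, x != y -> (0 < d x y)%R.
Variables (A B : {set V}) (E : {set V * V}).
Hypothesis shE : shortest d A B E.
Hypothesis loopless : forall x y, (x, y) \in E -> x != y.
Hypothesis deg3 : forall v, v \notin A :|: B -> 3 <= #|nbrs E v|.
Variable pth : V -> V -> seq V.
Hypothesis pthP : forall x y, conn E x y -> spath E x y (pth x y).

(** The strong component of v. *)
Definition comp v := [pred u | conn E v u && conn E u v].

Lemma comp_refl v : comp v v.
Proof. by rewrite /= conn0. Qed.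

Lemma comp_eq v u : comp v u -> comp u =1 comp v.
Proof.
move=> /andP[vu uv] w; apply/andP/andP=> -[xw wx]; split;
  by [apply: conn_trans vu xw | apply: conn_trans wx uv |
      apply: conn_trans uv xw | apply: conn_trans wx vu].
Qed.

Lemma spath_pairwise a b l : spath E a b l -> pairwise (conn E) l.
Proof.
move=> sp; have [Ul _ _ _] := sp; apply/(pairwiseP a) => i j; rewrite !inE => il jl ij.
apply: (conn_along Ul); rewrite ?mem_nth ?index_uniq //; first exact: ltnW.
by move=> x y xy _ _; apply: spath_edge sp xy.
Qed.

Section Pair.
Variables a b : V.
Hypothesis ab : conn E a b.

Let P := pth a b.
Definition segment v := [seq u <- pth a b | comp v u].
(** The default a is only reached when P misses the component of v; entry and
exit then agree, and the return path is trivial. *)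
Definition entry v := head a (segment v).
Definition exit v := last a (segment v).
Definition return_path v := pth (exit v) (entry v).

Let spP : spath E a b P. Proof. exact: pthP. Qed.
Let UP : uniq P. Proof. by case: spP. Qed.

Lemma segment_cat v : exists l0 l1, P = l0 ++ segment v ++ l1.
Proof.
have [|l0 [l1 [El _ _]]] := filter_convex _ (spath_pairwise spP) (D := comp v).
  move=> x y z /andP[vx xv] xy yz /andP[vz zv]; apply/andP; split.
    exact: conn_trans vx xy.
  exact: conn_trans yz zv.
by exists l0, l1.
Qed.

Lemma mem_segment v u : (u \in segment v) = comp v u && (u \in P).
Proof. by rewrite mem_filter. Qed.

Lemma segment_uniq v : uniq (segment v).
Proof. exact: filter_uniq. Qed.

Lemma index_segment v : exists n, forall u, u \in segment v ->
  index u P = n + index u (segment v).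
Proof.
have [l0 [l1 EP]] := segment_cat v; exists (size l0) => u us.
have := UP; rewrite EP cat_uniq => /and3P[_ /hasPn dis _].
rewrite index_cat index_cat us; case: ifP => // ul0.
by have := dis u; rewrite mem_cat us => /(_ isT)/negP; case.
Qed.

Lemma step_segment v x y : x \in segment v -> y \in segment v ->
  step (segment v) x y = step P x y.
Proof.
move=> xs ys; have [n nP] := index_segment v; rewrite /step ys !nP // -addnS eqn_add2l.
by move: ys; rewrite mem_segment => /andP[_ ->].
Qed.

Section Component.
Variable v : V.
Hypothesis v_met : segment v != [::].

Lemma entry_segment : entry v \in segment v.
Proof. by rewrite /entry; case: (segment v) v_met => //= x l _; rewrite inE eqxx. Qed.

Lemma exit_segment : exit v \in segment v.
Proof. by rewrite /exit; case: (segment v) v_met => //= x l _; apply: mem_last. Qed.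

Lemma segment_spath : spath E (entry v) (exit v) (segment v).
Proof.
have Us := segment_uniq v; split=> //.
- by rewrite /entry; case: (segment v) v_met => //= x l _; rewrite eqxx.
- rewrite /exit; case: (segment v) v_met Us => //= x l _ Us.
  by rewrite -[LHS]/(index (last x l) (x :: l)).+1 index_last.
apply/subsetP=> -[x y]; rewrite inE /= => xy; have [xs ys] := step_mem xy.
by apply: spath_edge spP _; rewrite -(step_segment xs ys).
Qed.

Lemma comp_entry : comp v (entry v).
Proof. by have := entry_segment; rewrite mem_segment => /andP[]. Qed.

Lemma comp_exit : comp v (exit v).
Proof. by have := exit_segment; rewrite mem_segment => /andP[]. Qed.

Lemma return_spath : spath E (exit v) (entry v) (return_path v).
Proof.
apply: pthP; have /andP[_ xv] := comp_exit; have /andP[vn _] := comp_entry.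
exact: conn_trans xv vn.
Qed.

Lemma comp_return u : u \in return_path v -> comp v u.
Proof.
move=> ur; have [Ur x0 n0 _] := return_spath.
have [xr nr] := spath_mem return_spath.
have /andP[vx _] := comp_exit; have /andP[_ nv] := comp_entry.
apply/andP; split.
  apply: conn_trans vx (conn_along Ur xr ur _ _); rewrite ?x0 // => p q pq _ _.
  exact: spath_edge return_spath pq.
apply: conn_trans (conn_along Ur ur nr _ _) nv.
  by rewrite -ltnS n0 index_mem.
by move=> p q pq _ _; apply: spath_edge return_spath pq.
Qed.

Lemma comp_visited u : u \in segment v ++ return_path v -> comp v u.
Proof.
by rewrite mem_cat => /orP[|/comp_return//]; rewrite mem_segment => /andP[].
Qed.

Lemma visited_segment u : u \in segment v ++ return_path v -> u \in P ->
  u \in segment v.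
Proof. by move=> /comp_visited vu uP; rewrite mem_segment vu. Qed.

(** The part of P in the component is contiguous, so P enters the component only
once, at its entry. *)
Lemma step_into x y : y \in segment v -> y != entry v -> step P x y ->
  step (segment v) x y.
Proof.
move=> ys yn xy; have [Us n0 _ _] := segment_spath.
have x'y : step (segment v) (prev (segment v) y) y.
  apply: prev_step => //; rewrite -n0; apply: contraNneq yn.
  by move=> /(index_inj v ys entry_segment) ->.
have [x's _] := step_mem x'y; rewrite -(step_prev UP xy).
have := x'y; rewrite (step_segment x's ys) => /(step_prev UP) ->.
exact: x'y.
Qed.

(** Likewise, P leaves the component only once, at its exit. *)
Lemma step_out_of x y : x \in segment v -> x != exit v -> step P x y ->
  step (segment v) x y.
Proof.
move=> xs nx xy; have [Us _ x0 _] := segment_spath.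
have xy' : step (segment v) x (next (segment v) x).
  apply: next_step => //; rewrite -x0; apply: contraNneq nx => -[].
  by move=> /(index_inj v xs exit_segment) ->.
have [_ y's] := step_mem xy'; rewrite -(step_next UP xy).
have := xy'; rewrite (step_segment xs y's) => /(step_next UP) ->.
exact: xy'.
Qed.

End Component.

Definition skeleton v := edges_of P :|: edges_of (return_path v).

Definition visited v u := (segment v != [::]) && (u \in segment v ++ return_path v).

Definition entered u := visited u u && [exists x, (x, u) \in E :\: skeleton u].
Definition exited u := visited u u && [exists x, (u, x) \in E :\: skeleton u].

Definition attached u :=
  visited u u && (u \in A :|: B) || entered u || exited u.

Lemma comp_segment v u : comp v u -> segment u = segment v.
Proof. by move=> vu; apply: eq_filter; apply: comp_eq. Qed.

Lemma comp_return_path v u : comp v u -> return_path u = return_path v.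
Proof. by move=> vu; rewrite /return_path /exit /entry (comp_segment vu). Qed.

Lemma comp_skeleton v u : comp v u -> skeleton u = skeleton v.
Proof. by move=> vu; rewrite /skeleton (comp_return_path vu). Qed.

Lemma comp_visited_eq v u w : comp v u -> visited u w = visited v w.
Proof.
by move=> vu; rewrite /visited (comp_segment vu) (comp_return_path vu).
Qed.

Lemma skeleton_sub v : segment v != [::] -> skeleton v \subset E.
Proof.
move=> vm; rewrite subUset; have [_ _ _ ->] := spP.
by have [_ _ _ ->] := return_spath vm.
Qed.

Lemma path_conn (F : {set V * V}) x y : edges_of P \subset F -> x \in P -> y \in P ->
  index x P <= index y P -> conn F x y.
Proof.
move=> /subsetP sPF xP yP xy; apply: (conn_along UP xP yP xy) => p q pq _ _.
by apply: sPF; rewrite inE.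
Qed.

(** Segment and return path together form a closed walk. *)
Lemma skeleton_conn (F : {set V * V}) u : skeleton u \subset F -> visited u u ->
  conn F u (entry u) /\ conn F (entry u) u.
Proof.
rewrite subUset => /andP[sPF /subsetP sQF] /andP[um uv].
have eP := entry_segment um; have xP := exit_segment um.
move: eP xP; rewrite !mem_segment => /andP[_ eP] /andP[_ xP].
have sp := return_spath um; have [Ur x0 n0 _] := sp; have [xr nr] := spath_mem sp.
have along x y : x \in return_path u -> y \in return_path u ->
    index x (return_path u) <= index y (return_path u) -> conn F x y.
  move=> xq yq xy; apply: (conn_along Ur xq yq xy) => p q pq _ _.
  by apply: sQF; rewrite inE.
have xn : conn F (exit u) (entry u) by apply: along; rewrite ?x0.
have [us|us] := boolP (u \in segment u).
  have uP : u \in P by move: us; rewrite mem_segment => /andP[].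
  have [n nP] := index_segment u; have [_ s0 e0 _] := segment_spath um.
  split.
    apply: conn_trans xn; apply: path_conn => //.
    by rewrite !nP ?exit_segment // leq_add2l -ltnS e0 index_mem.
  by apply: path_conn => //; rewrite !nP ?entry_segment // s0 leq_add2l.
have ur : u \in return_path u by move: uv; rewrite mem_cat (negbTE us).
split; first by apply: along => //; rewrite -ltnS n0 index_mem.
apply: conn_trans (along _ _ xr ur _); last by rewrite x0.
have [n nP] := index_segment u; have [_ s0 e0 _] := segment_spath um.
apply: path_conn => //; rewrite !nP ?exit_segment ?entry_segment //.
by rewrite s0 leq_add2l.
Qed.

(** Components met by P are met in some order, and P leads from each of them to
the later ones: this is the connectivity that same_critical_edge asks for. *)
Lemma visited_conn (F : {set V * V}) u u' : skeleton u \subset F -> skeleton u' \subset F ->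
  visited u u -> visited u' u' ->
  (conn F u u' \/ conn F u' u) /\
  (conn E u u' -> conn E u' u -> conn F u u' /\ conn F u' u).
Proof.
move=> sF sF' vu vu'; have [ue eu] := skeleton_conn sF vu.
have [ue' eu'] := skeleton_conn sF' vu'.
split; last first.
  move=> uu' u'u; have cuu' : comp u u' by rewrite /= uu' u'u.
  have Ee : entry u' = entry u by rewrite /entry (comp_segment cuu').
  by rewrite Ee in ue' eu'; split;
     [apply: conn_trans ue eu' | apply: conn_trans ue' eu].
have sPF : edges_of P \subset F by move: sF; rewrite subUset => /andP[].
have inP w : visited w w -> entry w \in P.
  by move=> /andP[/entry_segment + _]; rewrite mem_segment => /andP[].
case: (leqP (index (entry u) P) (index (entry u') P)) => [le|/ltnW le].
  by left; apply: conn_trans (conn_trans ue (path_conn sPF _ _ le)) eu'; apply: inP.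
by right; apply: conn_trans (conn_trans ue' (path_conn sPF _ _ le)) eu; apply: inP.
Qed.

(** A return path stays in its component, so it contains an edge at u only if it
is the return path of u. *)
Lemma skeletonU_notin u u' x e : visited u u -> visited u' u' ->
  e \in E :\: skeleton u -> e = (x, u) \/ e = (u, x) ->
  e \in E :\: (skeleton u :|: skeleton u').
Proof.
move=> vu vu' /setDP[eE nsk] ex; apply/setDP; split=> //.
rewrite inE negb_or nsk /=; apply: contra nsk => /setUP[]; rewrite !inE => st.
  by rewrite st.
have /andP[um' _] := vu'; have [e1 e2] := step_mem st.
suff u'u : comp u' u.
  by rewrite (comp_return_path u'u) st orbT.
by case: ex e1 e2 => -> /= e1 e2; apply: comp_return.
Qed.

(** To an entering edge (x,u) corresponds a terminal c from which u can only be
reached through that edge; same_critical_edge makes this injective. *)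
Lemma card_entered : #|[set u | entered u]| <= #|A|.
Proof.
pose r u c := [exists x, [&& (x, u) \in E :\: skeleton u, conn E c u &
  ~~ conn (E :\ (x, u)) c u]].
apply: (@leq_card_rel _ _ _ _ r) => [u|u u' c].
  rewrite inE => /andP[vu /existsP[x xu]]; have /setDP[xuE _] := xu.
  have [c [e [cA eB nce]]] := critical d_ge0 d_gt0 shE loopless xuE.
  exists c => //; apply/existsP; exists x; rewrite xu /=.
  case: (conn_split (x, u) (shE.1 c e cA eB)) => [ce|[/= cx ue]].
    by rewrite ce in nce.
  apply/andP; split; last by apply: contra nce => cu; apply: conn_trans cu ue.
  by apply: conn_trans (conn_sub (subD1set _ _) cx) (conn1 xuE).
rewrite !inE => /andP[vu _] /andP[vu' _].
case/existsP=> x /and3P[xu cu ncu] /existsP[x' /and3P[xu' cu' ncu']].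
have [/andP[um _] /andP[um' _]] := (vu, vu').
have [or_ back] := visited_conn (subsetUl (skeleton u) (skeleton u'))
  (subsetUr _ _) vu vu'.
have sFE : skeleton u :|: skeleton u' \subset E by rewrite subUset !skeleton_sub.
have h := skeletonU_notin vu vu' xu (or_introl erefl).
have h' := skeletonU_notin vu' vu xu' (or_introl erefl); rewrite setUC in h'.
by case: (same_critical_edge sFE h h' cu cu' ncu ncu' or_ back).
Qed.

(** The mirror image of card_entered: reverse all edges. *)
Lemma card_exited : #|[set u | exited u]| <= #|B|.
Proof.
pose r u c := [exists x, [&& (u, x) \in E :\: skeleton u, conn E u c &
  ~~ conn (E :\ (u, x)) u c]].
apply: (@leq_card_rel _ _ _ _ r) => [u|u u' c].
  rewrite inE => /andP[vu /existsP[x ux]]; have /setDP[uxE _] := ux.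
  have [e [c [eA cB nec]]] := critical d_ge0 d_gt0 shE loopless uxE.
  exists c => //; apply/existsP; exists x; rewrite ux /=.
  case: (conn_split (u, x) (shE.1 e c eA cB)) => [ec|[/= eu xc]].
    by rewrite ec in nec.
  apply/andP; split; last by apply: contra nec => uc; apply: conn_trans eu uc.
  by apply: conn_trans (conn1 uxE) (conn_sub (subD1set _ _) xc).
rewrite !inE => /andP[vu _] /andP[vu' _].
case/existsP=> x /and3P[ux uc nuc] /existsP[x' /and3P[ux' uc' nuc']].
have [/andP[um _] /andP[um' _]] := (vu, vu').
have [or_ back] := visited_conn (subsetUl (skeleton u) (skeleton u'))
  (subsetUr _ _) vu vu'.
have sFE : skeleton u :|: skeleton u' \subset E by rewrite subUset !skeleton_sub.
have h := skeletonU_notin vu vu' ux (or_intror erefl).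
have h' := skeletonU_notin vu' vu ux' (or_intror erefl); rewrite setUC in h'.
have revD y z : rev_edges E :\ (z, y) = rev_edges (E :\ (y, z)).
  by apply/setP=> -[p q]; rewrite !inE !xpair_eqE [(p == z) && _]andbC.
case: (@same_critical_edge _ (rev_edges (skeleton u :|: skeleton u'))
  (rev_edges E) c x u x' u'); rewrite ?revD ?conn_rev //.
- by case.
- by apply/subsetP=> -[y z]; rewrite !in_rev; apply: (subsetP sFE).
- by rewrite in_setD !in_rev -in_setD.
- by rewrite in_setD !in_rev -in_setD.
- by case: or_; auto.
by move=> u'u uu'; apply/and_comm/back.
Qed.

Lemma card_attached : #|[set u | attached u]| <= 2 * (#|A| + #|B|).
Proof.
have sub : [set u | attached u] \subset
    A :|: B :|: [set u | entered u] :|: [set u | exited u].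
  apply/subsetP=> u; rewrite inE => /orP[/orP[/andP[_ uT]|ue]|ul]; apply/setUP.
  - by left; apply/setUP; left.
  - by left; apply/setUP; right; rewrite inE.
  - by right; rewrite inE.
have := subset_leq_card sub; have := card_entered; have := card_exited.
have := leq_card_setU (A :|: B :|: [set u | entered u]) [set u | exited u].
have := leq_card_setU (A :|: B) [set u | entered u].
have := leq_card_setU A B => -[h1 _] [h2 _] [h3 _] h4 h5 h6.
lia.
Qed.

Section Unattached.
Variable v : V.
Hypothesis vP : v \in P.
Hypothesis v_steiner : v \notin A :|: B.

Let vs : v \in segment v. Proof. by rewrite mem_segment comp_refl. Qed.
Let v_met : segment v != [::]. Proof. by apply: contraTneq vs => ->. Qed.
Let seg := segment v.
Let ret := return_path v.

Lemma not_attached u : u \in seg ++ ret -> ~~ attached u ->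
  [/\ u \notin A :|: B, forall x, (x, u) \in E -> step P x u || step ret x u
    & forall x, (u, x) \in E -> step P u x || step ret u x].
Proof.
move=> uv; have vu := comp_visited v_met uv.
have vuu : visited u u by rewrite (comp_visited_eq _ vu) /visited v_met.
rewrite /attached /entered /exited vuu /= -orbA !negb_or.
case/and3P=> uT /existsPn nin /existsPn nout; split=> // x xu.
  have := nin x; rewrite in_setD xu andbT negbK (comp_skeleton vu).
  by rewrite in_setU !in_set.
have := nout x; rewrite in_setD xu andbT negbK (comp_skeleton vu).
by rewrite in_setU !in_set.
Qed.

(** Suppose that no vertex on the segment or on the return path is attached.
If entry and exit agree, then v has only its two neighbours along P.  Otherwise
walks reach these vertices only by the edge of P into the entry and leave them
only by the edge of P out of the exit.  The segment alone carries such walks, so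
the first edge of the return path is superfluous. *)
Lemma attached_exists : exists2 u, attached u & comp v u.
Proof.
have [/existsP[u /andP[]]|/existsPn none] := boolP [exists u, attached u && comp v u].
  by exists u.
exfalso; have {}none u : u \in seg ++ ret ->
  [/\ u \notin A :|: B, forall x, (x, u) \in E -> step P x u || step ret x u
    & forall x, (u, x) \in E -> step P u x || step ret u x].
  move=> uv; apply: not_attached => //.
  by have := none u; rewrite (comp_visited v_met uv) andbT.
have sps := segment_spath v_met; have spr := return_spath v_met.
have [Us n0 x0 _] := sps; have [Ur x0' n0' _] := spr.
have [xr nr] := spath_mem spr.
have visited_of u : u \in seg -> u \in seg ++ ret by rewrite mem_cat => ->.
have [nx|nnx] := eqVneq (exit v) (entry v).
  have no_ret x y : step ret x y = false.
    apply/negP=> /andP[yr /eqP xy]; move: yr; rewrite -index_mem xy -n0' -nx x0'.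
    by rewrite ltnS.
  have [_ inv outv] := none v (visited_of _ vs).
  have := deg3 v_steiner; rewrite leqNgt ltnS (path_degree UP) // => u uv.
    by have := inv u uv; rewrite no_ret orbF.
  by have := outv u uv; rewrite no_ret orbF.
(* The superfluous edge is the first one of the return path. *)
have xy : step ret (exit v) (next ret (exit v)).
  apply: next_step => //; rewrite -n0'; apply: contraNneq nnx => -[].
  by move/(index_inj v xr nr) ->.
move: (next ret (exit v)) xy => y xy; have [_ yr] := step_mem xy.
have xyE := spath_edge spr xy.
have [a' [b' [aA bB /negP]]] := critical d_ge0 d_gt0 shE loopless xyE; apply.
set E' := E :\ _.
(* All vertices of the segment and the return path are moved to the entry. *)
pose phi u := if u \in seg ++ ret then entry v else u.
have phiT u : u \in A :|: B -> phi u = u.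
  by rewrite /phi; case: ifP => // /none[/negbTE ->].
rewrite -[a']phiT ?inE ?aA // -[b']phiT ?inE ?bB ?orbT //.
apply: conn_retract (shE.1 _ _ aA bB) => p q pq.
have stay r1 r2 : (r1, r2) \in E -> (r1 \notin seg ++ ret) || (r2 \notin seg ++ ret) ->
    conn E' r1 r2.
  move=> rE out; apply: conn1; rewrite !inE rE andbT.
  apply: contraTneq out => -[-> ->]; rewrite negb_or !negbK !mem_cat xr yr.
  by rewrite !orbT.
rewrite /phi; case: ifP => pv; case: ifP => qv; first exact: conn0; last first.
- by apply: stay => //; rewrite pv.
- have qE : q = entry v.
    apply: contraFeq pv => nq; have [_ inq _] := none q qv.
    case/orP: (inq p pq) => [Ppq|/step_mem[pr _]]; last by rewrite mem_cat pr orbT.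
    have qs := visited_segment v_met qv (step_mem Ppq).2.
    by rewrite mem_cat (step_mem (step_into v_met qs nq Ppq)).1.
  by rewrite -qE; apply: stay => //; rewrite pv.
have pE : p = exit v.
  apply: contraFeq qv => np; have [_ _ outp] := none p pv.
  case/orP: (outp q pq) => [Ppq|/step_mem[_ qr]]; last by rewrite mem_cat qr orbT.
  have ps := visited_segment v_met pv (step_mem Ppq).1.
  by rewrite mem_cat (step_mem (step_out_of v_met ps np Ppq)).2.
apply: conn_trans (stay p q pq _); last by rewrite qv orbT.
have [ns xs] := (entry_segment v_met, exit_segment v_met).
rewrite pE; apply: (conn_along Us ns xs); first by rewrite n0.
move=> r1 r2 r12 _ _; rewrite !inE (spath_edge sps r12) andbT.
apply: contraTneq r12 => -[-> _]; apply/negP => /andP[r2s /eqP r2x].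
by move: r2s; rewrite -index_mem r2x x0 ltnn.
Qed.

Definition marked := [set u | attached u && comp v u] :|: [set entry v; exit v].

(** Edges of P at the entry or the exit may leave the component, hence these two
vertices are marked along with the attached ones. *)
Lemma component_antiparallel :
  antiparallel A B E (entry v) (exit v) seg ret marked.
Proof.
have unm u : u \in seg ++ ret -> u \notin marked ->
    [/\ ~~ attached u, u != entry v & u != exit v].
  move=> uv; rewrite in_setU in_set (comp_visited v_met uv) andbT in_set2 !negb_or.
  by case/and3P.
split.
- exact: segment_spath.
- exact: return_spath.
- by rewrite !inE eqxx orbT.
- by rewrite !inE eqxx !orbT.
- move=> u x uv /(unm u uv)[na nn _] xu; have [_ inu _] := not_attached uv na.
  case/orP: (inu x xu) => [Pxu|->]; last by rewrite orbT.
  have us := visited_segment v_met uv (step_mem Pxu).2.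
  by rewrite (step_into v_met us nn Pxu).
- move=> u x uv /(unm u uv)[na _ nx] ux; have [_ _ outu] := not_attached uv na.
  case/orP: (outu x ux) => [Pux|->]; last by rewrite orbT.
  have us := visited_segment v_met uv (step_mem Pux).1.
  by rewrite (step_out_of v_met us nx Pux).
- by move=> u uv /(unm u uv)[na _ _]; have [uT _ _] := not_attached uv na; apply: deg3.
by move=> u uv /(unm u uv)[na _ _]; have [uT _ _] := not_attached uv na.
Qed.

End Unattached.

Definition cell u := flatten
  [seq vicinity (segment u) (return_path u) 4 w | w <- [:: u; entry u; exit u]].

(** Three vicinities of 5 ^ 4 vertices each. *)
Lemma size_cell u : size (cell u) = 1875.
Proof.
by rewrite /cell size_flatten /shape -map_comp (eq_map (g := fun=> 625)).
Qed.

(** If the nearby marked vertex is only an entry or an exit, an attached vertex of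
the same component stands in for it: it determines the segment, hence its ends. *)
Lemma steiner_in_cell v : v \in P -> v \notin A :|: B ->
  exists2 u, attached u & v \in cell u.
Proof.
move=> vP vT; have vs : v \in segment v by rewrite mem_segment comp_refl.
have v_met : segment v != [::] by apply: contraTneq vs => ->.
have ap := component_antiparallel vP.
have vv : v \in segment v ++ return_path v by rewrite mem_cat vs.
have /hasP[w wball wM] := marked_nearby dC d_ge0 d_gt0 shE loopless ap vv.
have [Us _ _ _] := ap_P ap; have [Ur _ _ _] := ap_Q ap.
have {}wball := vicinity_sym Us Ur wball.
have [u0 at0 vu0] := attached_exists vP vT.
have [u [atu vu wu]] : exists u, [/\ attached u, comp v u &
    w \in [:: u; entry v; exit v]].
  move: wM; rewrite /= in_setU in_set in_set2 => /orP[/andP[aw vw]|wnx].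
    by exists w; split; rewrite // inE eqxx.
  by exists u0; split; rewrite // !inE wnx orbT.
exists u => //; apply/flattenP; exists (vicinity (segment v) (return_path v) 4 w) => //.
rewrite (comp_segment vu) (comp_return_path vu).
by apply: map_f; rewrite /entry /exit (comp_segment vu).
Qed.

Lemma card_steiner_on_path :
  #|[set v | (v \in P) && (v \notin A :|: B)]| <= 3750 * (#|A| + #|B|).
Proof.
set S := [set v | _]; set T := [set u | attached u].
have sub : {subset S <= flatten [seq cell u | u <- enum T]}.
  move=> v; rewrite inE => /andP[vP vT]; have [u au vu] := steiner_in_cell vP vT.
  by apply/flattenP; exists (cell u) => //; apply: map_f; rewrite mem_enum inE.
have size_cells l : size (flatten [seq cell u | u <- l]) = 1875 * size l.
  rewrite size_flatten /shape -map_comp (eq_map (g := fun=> 1875)); last first.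
    exact: size_cell.
  by elim: l => [//|u l IHl]; rewrite [LHS]/= IHl -mulnS.
have := card_attached; rewrite -/T cardE => leT.
apply: (@leq_trans (size (flatten [seq cell u | u <- enum T]))); last first.
  by rewrite size_cells -[3750]/(1875 * 2) -mulnA leq_mul2l leT orbT.
by rewrite cardE; apply: uniq_leq_size (enum_uniq _) _ => v; rewrite mem_enum => /sub.
Qed.

End Pair.

Lemma critical_on_path a b x y : conn E a b -> ~~ conn (E :\ (x, y)) a b ->
  step (pth a b) x y.
Proof.
move=> ab; have sp := pthP ab; have [aP bP] := spath_mem sp; have [UP a0 b0 _] := sp.
apply: contraR => nxy; apply: (conn_along UP aP bP); first by rewrite a0.
move=> p q pq _ _; rewrite !inE (spath_edge sp pq) andbT.
by apply: contraNneq nxy => -[<- <-].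
Qed.

(** A Steiner point has an edge, and this edge lies on the path of every pair for
which it is critical. *)
Lemma card_steiner :
  #|~: (A :|: B)| <= 3750 * (#|A| ^ 2 * #|B| + #|A| * #|B| ^ 2).
Proof.
pose S a b := [set v | (v \in pth a b) && (v \notin A :|: B)].
have sub : ~: (A :|: B) \subset \bigcup_(a in A) \bigcup_(b in B) S a b.
  apply/subsetP=> v; rewrite inE => vT; have := deg3 vT.
  case/(leq_trans (isT : 0 < 3))/card_gt0P => w; rewrite inE => /andP[_ vw].
  have [x [y [xyE vxy]]] : exists x y, (x, y) \in E /\ (v == x) || (v == y).
    by case/orP: vw => vw; [exists v, w|exists w, v]; rewrite eqxx ?orbT.
  have [a [b [aA bB nab]]] := critical d_ge0 d_gt0 shE loopless xyE.
  have /step_mem[xP yP] := critical_on_path (shE.1 a b aA bB) nab.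
  apply/bigcupP; exists a => //; apply/bigcupP; exists b => //.
  by rewrite inE vT andbT; case/orP: vxy => /eqP->.
apply: leq_trans (subset_leq_card sub) _.
have -> : 3750 * (#|A| ^ 2 * #|B| + #|A| * #|B| ^ 2) =
    #|A| * (#|B| * (3750 * (#|A| + #|B|))) by lia.
apply: leq_card_bigcup => a aA; apply: leq_card_bigcup => b bB.
exact: card_steiner_on_path (shE.1 a b aA bB).
Qed.

End Counting.

Local Open Scope fset_scope.
Local Open Scope ring_scope.

(** * Digraphs in a metric space *)
Section Transfer.
Variables (R : realType) (X : metricType R) (G : digraph X).

Let V : finType := vertices G.
Let d (u v : V) : R := mdist (val u) (val v).
Definition on_vertices (S : {fset X}) : {set V} := [set v : V | val v \in S].
Definition edges_on_vertices : {set V * V} :=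
  [set e : V * V | (val e.1, val e.2) \in edges G].

Lemma card_on_vertices (S : {fset X}) : S `<=` vertices G -> #|on_vertices S| = #|` S|.
Proof.
move=> /fsubsetP sSG; rewrite cardE -(size_map val).
apply/perm_size/uniq_perm; rewrite ?fset_uniq //.
  by rewrite (map_inj_uniq val_inj) enum_uniq.
move=> x; apply/mapP/idP => [[v + ->]|xS]; first by rewrite mem_enum inE.
by exists [` sSG x xS]; rewrite ?mem_enum ?inE.
Qed.

Lemma length_on_vertices (S : {fset X * X}) (F : {set V * V}) :
    (forall u v, ((val u, val v) \in S) = ((u, v) \in F)) ->
    (forall x y, (x, y) \in S -> x \in vertices G /\ y \in vertices G) ->
  \sum_(e <- S) mdist e.1 e.2 = len d F.
Proof.
move=> SF SG; rewrite /len -big_enum /=.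
pose f (e : V * V) := (val e.1, val e.2).
have f_inj : injective f by move=> [u v] [u' v'] [/val_inj-> /val_inj->].
rewrite -(big_map f xpredT (fun e => mdist e.1 e.2)).
apply/perm_big/uniq_perm; rewrite ?fset_uniq //.
  by rewrite (map_inj_uniq f_inj) enum_uniq.
move=> [x y]; apply/idP/mapP => [xyS|[[u v] + ->]]; last by rewrite mem_enum -SF.
have [xG yG] := SG x y xyS; exists ([` xG], [` yG]) => //.
by rewrite mem_enum -SF.
Qed.

Lemma conn_of_dipath (u v : V) : dipath G (val u) (val v) -> conn edges_on_vertices u v.
Proof.
case=> _ [p [Gp _ pv]]; elim: p u Gp pv => [|x p IHp] u /=.
  by move=> _ /val_inj ->; apply: conn0.
case/andP=> ux Gp pv; have [_ xG _] := edgesP ux.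
apply: (@conn_trans _ _ [` xG]); last exact: IHp.
by apply: conn1; rewrite inE.
Qed.

Section Outside.
Variable F : {set V * V}.

Let edge_seq := [seq (val e.1, val e.2) | e <- enum F & e.1 != e.2].
Definition digraph_of_edges : {fset X * X} := seq_fset tt edge_seq.

Lemma mem_digraph_of_edges (u v : V) :
  ((val u, val v) \in digraph_of_edges) = ((u, v) \in F) && (u != v).
Proof.
rewrite seq_fsetE; apply/mapP/andP => [[[u' v']]|[uvF uv]].
  by rewrite mem_filter mem_enum /= => /andP[? ?] [/val_inj-> /val_inj->].
by exists (u, v); rewrite // mem_filter mem_enum uvF /= uv.
Qed.

Lemma digraph_of_edgesP x y : (x, y) \in digraph_of_edges ->
  [/\ x \in vertices G, y \in vertices G & x != y].
Proof.
rewrite seq_fsetE => /mapP[[u v]]; rewrite mem_filter => /andP[/= uv _] [-> ->].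
by split; rewrite ?fsvalP // (inj_eq val_inj).
Qed.

Definition digraph_of := Digraph digraph_of_edgesP.

Lemma dipath_digraph_of (u v : V) : conn F u v -> dipath digraph_of (val u) (val v).
Proof.
case/connectP=> p0 Fp0 ->; case/shortenP: Fp0 => p Fp Up _; split.
  exact: fsvalP.
exists (map val p); split; last by rewrite last_map.
  elim: p u Fp Up => //= w p IHp u /andP[uw Fp] /andP[+ Up].
  rewrite inE negb_or => /andP[nuw _]; apply/andP; split; last exact: IHp.
  by rewrite /edge_rel /= mem_digraph_of_edges uw.
by rewrite -map_cons (map_inj_uniq val_inj).
Qed.

Lemma length_digraph_of : network_length digraph_of <= len d F.
Proof.
rewrite /network_length (@length_on_vertices _ [set e in F | e.1 != e.2]).
- rewrite /len [leRHS](big_setID [set e in F | e.1 != e.2]) /=.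
  have /setIidPr -> : [set e in F | e.1 != e.2] \subset F.
    by apply/subsetP=> e; rewrite inE => /andP[].
  by rewrite lerDl; apply: sumr_ge0 => e _; apply: mdist_ge0.
- by move=> u v; rewrite /= mem_digraph_of_edges inE.
by move=> x y /digraph_of_edgesP[].
Qed.

End Outside.

End Transfer.

Theorem theorem1 (R : realType) :
  exists C : R, 0 < C /\
    forall (X : metricType R) (A B : {fset X}) (m n : nat),
      #|` A| = m -> #|` B| = n ->
      forall G : digraph X,
        simple_network A B G -> shortest_network A B G ->
        #|` steiner_points A B G|%:R <= C * (m ^ 2 * n + m * n ^ 2)%N%:R.
Proof.
exists 3750%:R; split; first by rewrite ltr0n.
move=> X A B m n <- <- G [[ABG conG] deg] [_ minG].
have [AG BG] : A `<=` vertices G /\ B `<=` vertices G.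
  by move: ABG; rewrite fsubUset => /andP[].
pose d (u v : vertices G) : R := mdist (val u) (val v).
have TE : on_vertices G (A `|` B) = on_vertices G A :|: on_vertices G B.
  by apply/setP=> v; rewrite !inE.
have stE : on_vertices G (steiner_points A B G) = ~: (on_vertices G A :|: on_vertices G B).
  by rewrite -TE; apply/setP=> v; rewrite !inE fsvalP andbT.
rewrite -(card_on_vertices (G := G)); last by apply: fsubsetDl.
rewrite stE -(card_on_vertices AG) -(card_on_vertices BG) -natrM ler_nat.
have pathP (uv : vertices G * vertices G) : exists l,
    conn (edges_on_vertices G) uv.1 uv.2 -> spath (edges_on_vertices G) uv.1 uv.2 l.
  have [/spath_exists[l sl]|_] := boolP (conn (edges_on_vertices G) uv.1 uv.2).
    by exists l.
  by exists [::].
have [pth pthP] := choice pathP.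
apply: (@card_steiner R _ d _ _ _ _ _ (edges_on_vertices G) _ _ _
  (fun u v => pth (u, v))).
- by move=> u v; apply: metric_sym.
- by move=> u v; apply: mdist_ge0.
- by move=> u v uv; rewrite mdist_gt0 (inj_eq val_inj).
- split.
    by move=> u v; rewrite !inE => uA vB; apply/conn_of_dipath/conG.
  move=> F jF; rewrite -(@length_on_vertices _ _ G (edges G)); last 2 first.
  + by move=> u v; rewrite inE.
  + by move=> x y /edgesP[].
  apply: le_trans (minG (digraph_of F) _) (length_digraph_of F); split=> // a b aA bB.
  have := @dipath_digraph_of _ _ G F [` fsubsetP AG a aA] [` fsubsetP BG b bB].
  by apply; apply: jF; rewrite inE.
- by move=> u v; rewrite inE => /edgesP[_ _]; rewrite (inj_eq val_inj).
- move=> v; rewrite -in_setC -stE inE => /deg; congr (_ <= _)%N.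
  rewrite -(card_on_vertices (G := G)); last by apply/fsubsetP=> x; rewrite !inE => /andP[].
  apply: eq_card => w; rewrite !inE fsvalP /= (inj_eq val_inj) /=.
  by rewrite /edge_rel.
by move=> u v; apply: (pthP (u, v)).
Qed.
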